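(* Let $(A,\cdot,\delta,D,Q)$ be a commutative and cocommutative differential antisymmetric infinitesimal (ASI) bialgebra and let $q\in\mathbf{k}$. Define a binary operation $\circ_q$ and a coproduct $\Delta_q$ on $A$ by $$a\circ_q b:=a\cdot(D+qQ)(b),\qquad \Delta_q(a):=(\mathrm{id}\otimes(Q+qD))\delta(a),\qquad a,b\in A.$$ (a) When $q=-\frac12$, $(A,\circ_{-\frac12},\Delta_{-\frac12})$ is a Novikov bialgebra (without any further condition). (b) For other $q\in\mathbf{k}$, if $$a\cdot Q(b)=-a\cdot D(b)\ \text{ for all } a,b\in A,\qquad\text{and}\qquad (\mathrm{id}\otimes Q)\delta=-(\mathrm{id}\otimes D)\delta,$$ then $(A,\circ_q,\Delta_q)$ is a Novikov bialgebra. In particular, if $Q=-D$, then $(A,\circ_q,\Delta_q)$ is a Novikov bialgebra.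
   Context: $\mathbf{k}$ is a field of characteristic $0$; all vector spaces are over $\mathbf{k}$ and finite-dimensional. $\tau(a\otimes b)=b\otimes a$. For a binary operation $*$ on $A$, $L_*(a)b=a*b$ and $R_*(a)b=b*a$. Admissible commutative differential algebra $(A,\cdot,D,Q)$: $(A,\cdot)$ is a commutative associative algebra, $D,Q:A\to A$ are linear, $D(a\cdot b)=D(a)\cdot b+a\cdot D(b)$ and $Q(a\cdot b)=Q(a)\cdot b-a\cdot D(b)$. Admissible cocommutative differential coalgebra $(A,\delta,Q,D)$: $\delta:A\to A\otimes A$ is linear with $(\delta\otimes\mathrm{id})\delta=(\mathrm{id}\otimes\delta)\delta$, $\delta=\tau\delta$, $Q$ is a coderivation, i.e. $\delta Q=(\mathrm{id}\otimes Q+Q\otimes\mathrm{id})\delta$, and $D:A\to A$ is linear with $\delta D=(D\otimes\mathrm{id}-\mathrm{id}\otimes Q)\delta$. ASI bialgebra $(A,\cdot,\delta)$: $(A,\cdot)$ is an associative algebra, $(A,\delta)$ a coassociative coalgebra, and for all $a,b$: $\delta(a\cdot b)=(\mathrm{id}\otimes L_\cdot(a))\delta(b)+(R_\cdot(b)\otimes\mathrm{id})\delta(a)$ and $(L_\cdot(b)\otimes\mathrm{id}-\mathrm{id}\otimes R_\cdot(b))\delta(a)+\tau\big((L_\cdot(a)\otimes\mathrm{id}-\mathrm{id}\otimes R_\cdot(a))\delta(b)\big)=0$. A commutative and cocommutative differential ASI bialgebra is a quintuple $(A,\cdot,\delta,D,Q)$ such that $(A,\cdot,\delta)$ is an ASI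 bialgebra, $(A,\cdot,D,Q)$ is an admissible commutative differential algebra, and $(A,\delta,Q,D)$ is an admissible cocommutative differential coalgebra. Novikov algebra $(A,\circ)$: $(a\circ b)\circ c-a\circ(b\circ c)=(b\circ a)\circ c-b\circ(a\circ c)$ and $(a\circ b)\circ c=(a\circ c)\circ b$. Write $a\star b:=a\circ b+b\circ a$. Novikov coalgebra $(A,\Delta)$: $\Delta:A\to A\otimes A$ linear with $(\mathrm{id}\otimes\Delta)\Delta(a)-(\tau\otimes\mathrm{id})(\mathrm{id}\otimes\Delta)\Delta(a)=(\Delta\otimes\mathrm{id})\Delta(a)-(\tau\otimes\mathrm{id})(\Delta\otimes\mathrm{id})\Delta(a)$ and $(\tau\otimes\mathrm{id})(\mathrm{id}\otimes\Delta)\tau\Delta(a)=(\Delta\otimes\mathrm{id})\Delta(a)$. Novikov bialgebra $(A,\circ,\Delta)$: $(A,\circ)$ is a Novikov algebra, $(A,\Delta)$ is a Novikov coalgebra, and for all $a,b\in A$: (1) $\Delta(a\circ b)=(R_\circ(b)\otimes\mathrm{id})\Delta(a)+(\mathrm{id}\otimes L_\star(a))(\Delta(b)+\tau\Delta(b))$; (2) $(L_\star(a)\otimes\mathrm{id})\Delta(b)-(\mathrm{id}\otimes L_\star(a))\tau\Delta(b)=(L_\star(b)\otimes\mathrm{id})\Delta(a)-(\mathrm{id}\otimes L_\star(b))\tau\Delta(a)$; (3) $(\mathrm{id}\otimes R_\circ(a)-R_\circ(a)\otimes\mathrm{id})(\Delta(b)+\tau\Delta(b))=(\mathrm{id}\otimes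 R_\circ(b)-R_\circ(b)\otimes\mathrm{id})(\Delta(a)+\tau\Delta(a))$. *)

(* Defs.v *)
From HB Require Import structures.
From mathcomp Require Import all_boot all_order all_algebra.

Set Implicit Arguments.
Unset Strict Implicit.
Unset Printing Implicit Defensive.

Import GRing.Theory.
Local Open Scope ring_scope.

Section Tensor.
Variable k : fieldType.
Implicit Types U V W : vectType k.

(* The tensor product, as the space of coordinate matrices in the bases
   vbasis {:U} and vbasis {:V}; the universal property is given by tlift_pure,
   tlift_linear and tensor_ext below. *)
Definition tensor U V : vectType k := 'M[k]_(\dim {:U}, \dim {:V}).

Definition tpure U V (u : U) (v : V) : tensor U V :=
  \matrix_(i, j) (coord (vbasis {:U}) i u * coord (vbasis {:V}) j v).

(* The map U (x) V -> W induced by f, which is meant to be bilinear. *)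
Definition tlift U V W (f : U -> V -> W) (t : tensor U V) : W :=
  \sum_i \sum_j fun_of_matrix t i j *: f (vbasis {:U})`_i (vbasis {:V})`_j.

(* f (x) g; f and g are meant to be linear. *)
Definition tmap U V U' V' (f : U -> U') (g : V -> V') :
    tensor U V -> tensor U' V' :=
  tlift (fun u v => tpure (f u) (g v)).

Definition tswap U V : tensor U V -> tensor V U :=
  tlift (fun u v => tpure v u).

Definition tassoc U V W : tensor U (tensor V W) -> tensor (tensor U V) W :=
  tlift (fun u => tlift (fun v w => tpure (tpure u v) w)).

Lemma tpure_bilinear U V : bilinear_for *:%R *:%R (@tpure U V).
Proof.
split=> [v|u] a x y; apply/matrixP=> i j; rewrite !mxE linearP /=.
  by rewrite mulrDl mulrA.
by rewrite mulrDr mulrCA.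
Qed.

Lemma tlift_linear U V W (f : U -> V -> W) : linear (tlift f).
Proof.
move=> a s t; rewrite /tlift scaler_sumr -big_split; apply: eq_bigr => i _ /=.
rewrite scaler_sumr -big_split; apply: eq_bigr => j _ /=.
by rewrite !mxE scalerDl scalerA.
Qed.

Lemma tlift_pure U V W (f : U -> V -> W) u v :
  bilinear_for *:%R *:%R f -> tlift f (tpure u v) = f u v.
Proof.
case=> fl fr.
pose Fl v' : {linear U -> W} := HB.pack (f^~ v')
  (GRing.isLinear.Build k U W *:%R (f^~ v') (fl v')).
pose Fr u' : {linear V -> W} := HB.pack (f u')
  (GRing.isLinear.Build k V W *:%R (f u') (fr u')).
rewrite -[RHS]/(Fl v u) [in RHS](coord_vbasis (memvf u)) linear_sum.
apply: eq_bigr => i _; rewrite linearZ /= -[f _ v]/(Fr _ v).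
rewrite [in RHS](coord_vbasis (memvf v)) linear_sum scaler_sumr.
by apply: eq_bigr => j _; rewrite linearZ scalerA mxE.
Qed.

Lemma tensor_ext U V W (f g : tensor U V -> W) :
    linear f -> linear g ->
  (forall u v, f (tpure u v) = g (tpure u v)) -> f =1 g.
Proof.
move=> lf lg fg t.
pose F : {linear tensor U V -> W} := HB.pack f
  (GRing.isLinear.Build k (tensor U V) W *:%R f lf).
pose G : {linear tensor U V -> W} := HB.pack g
  (GRing.isLinear.Build k (tensor U V) W *:%R g lg).
have et : t = \sum_i \sum_j
    fun_of_matrix t i j *: tpure (vbasis {:U})`_i (vbasis {:V})`_j.
  rewrite [LHS](@matrix_sum_delta k); apply: eq_bigr => i _.
  apply: eq_bigr => j _; congr (_ *: _); apply/matrixP=> i' j'.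
  rewrite !mxE !(coord_free _ _ (basis_free (vbasisP _))).
  by rewrite -natrM mulnb [i == i']eq_sym [j == j']eq_sym.
rewrite et -[f]/(F : _ -> _) -[g]/(G : _ -> _) !linear_sum.
apply: eq_bigr => i _; rewrite !linear_sum; apply: eq_bigr => j _.
by rewrite !linearZ /= fg.
Qed.

Lemma tmap_pure U V U' V' (f : U -> U') (g : V -> V') u v :
  linear f -> linear g -> tmap f g (tpure u v) = tpure (f u) (g v).
Proof.
move=> lf lg; rewrite /tmap tlift_pure //; split=> [y|x] a z t /=.
  by rewrite lf (tpure_bilinear _ _).1.
by rewrite lg (tpure_bilinear _ _).2.
Qed.

Lemma tswap_pure U V (u : U) (v : V) : tswap (tpure u v) = tpure v u.
Proof.
rewrite /tswap tlift_pure //; split=> [y|x] a z t /=.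
  exact: (tpure_bilinear _ _).2.
exact: (tpure_bilinear _ _).1.
Qed.

Lemma tassoc_pure U V W (u : U) (v : V) (w : W) :
  tassoc (tpure u (tpure v w)) = tpure (tpure u v) w.
Proof.
have bl u' : bilinear_for *:%R *:%R (fun (v : V) (w : W) => tpure (tpure u' v) w).
  split=> [y|x] a z t /=; last exact: (tpure_bilinear _ _).2.
  by rewrite (tpure_bilinear _ _).2 (tpure_bilinear _ _).1.
rewrite /tassoc tlift_pure ?tlift_pure //; split=> [y|x] a z t /=;
  last exact: tlift_linear.
rewrite /tlift scaler_sumr -big_split; apply: eq_bigr => i _ /=.
rewrite scaler_sumr -big_split; apply: eq_bigr => j _ /=.
rewrite !(tpure_bilinear _ _).1 scalerDr !scalerA.
by rewrite [a * _]mulrC.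
Qed.

End Tensor.

Section Structures.
Variables (k : fieldType) (A : vectType k).
Implicit Types (mul op : A -> A -> A) (delta Delta : A -> tensor A A).
Implicit Types D Q : 'End(A).

Definition Lmul op (a b : A) : A := op a b.
Definition Rmul op (a b : A) : A := op b a.

Record assoc_algebra mul : Prop := AssocAlgebra {
  assoc_bilinear : bilinear_for *:%R *:%R mul;
  assoc_mulA : forall a b c, mul (mul a b) c = mul a (mul b c)
}.

Record coassoc_coalgebra delta : Prop := CoassocCoalgebra {
  coassoc_linear : linear delta;
  coassoc_coA : forall a,
    tmap delta id (delta a) = tassoc (tmap id delta (delta a))
}.

Record adm_comm_diff_algebra mul D Q : Prop := AdmCommDiffAlgebra {
  acda_assoc : assoc_algebra mul;
  acda_comm : forall a b, mul a b = mul b a;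
  acda_D : forall a b, D (mul a b) = mul (D a) b + mul a (D b);
  acda_Q : forall a b, Q (mul a b) = mul (Q a) b - mul a (D b)
}.

(* The order of D and Q is reversed here: the coderivation Q comes first. *)
Record adm_cocomm_diff_coalgebra delta Q D : Prop := AdmCocommDiffCoalgebra {
  acdc_coassoc : coassoc_coalgebra delta;
  acdc_cocomm : forall a, delta a = tswap (delta a);
  acdc_Q : forall a, delta (Q a) = (tmap id Q \+ tmap Q id) (delta a);
  acdc_D : forall a, delta (D a) = (tmap D id \- tmap id Q) (delta a)
}.

Record ASI_bialgebra mul delta : Prop := ASIBialgebra {
  asi_assoc : assoc_algebra mul;
  asi_coassoc : coassoc_coalgebra delta;
  asi_delta_mul : forall a b,
    delta (mul a b) =
      tmap id (Lmul mul a) (delta b) + tmap (Rmul mul b) id (delta a);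
  asi_antisym : forall a b,
    (tmap (Lmul mul b) id \- tmap id (Rmul mul b)) (delta a)
    + tswap ((tmap (Lmul mul a) id \- tmap id (Rmul mul a)) (delta b)) = 0
}.

Record comm_cocomm_diff_ASI_bialgebra mul delta D Q : Prop :=
  CommCocommDiffASIBialgebra {
  ccd_asi : ASI_bialgebra mul delta;
  ccd_alg : adm_comm_diff_algebra mul D Q;
  ccd_coalg : adm_cocomm_diff_coalgebra delta Q D
}.

Record novikov_algebra op : Prop := NovikovAlgebra {
  nov_bilinear : bilinear_for *:%R *:%R op;
  nov_lsym : forall a b c,
    op (op a b) c - op a (op b c) = op (op b a) c - op b (op a c);
  nov_rcomm : forall a b c, op (op a b) c = op (op a c) b
}.

(* Threefold tensors are compared in (A (x) A) (x) A, via tassoc. *)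
Record novikov_coalgebra Delta : Prop := NovikovCoalgebra {
  nov_linear : linear Delta;
  nov_colsym : forall a,
    tassoc (tmap id Delta (Delta a))
    - tmap (@tswap k A A) id (tassoc (tmap id Delta (Delta a)))
    = tmap Delta id (Delta a)
      - tmap (@tswap k A A) id (tmap Delta id (Delta a));
  nov_corcomm : forall a,
    tmap (@tswap k A A) id (tassoc (tmap id Delta (tswap (Delta a))))
    = tmap Delta id (Delta a)
}.

Definition star op (a b : A) : A := op a b + op b a.

Record novikov_bialgebra op Delta : Prop := NovikovBialgebra {
  nov_alg : novikov_algebra op;
  nov_coalg : novikov_coalgebra Delta;
  nov_compat1 : forall a b,
    Delta (op a b) =
      tmap (Rmul op b) id (Delta a)
      + tmap id (Lmul (star op) a) (Delta b + tswap (Delta b));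
  nov_compat2 : forall a b,
    tmap (Lmul (star op) a) id (Delta b)
    - tmap id (Lmul (star op) a) (tswap (Delta b))
    = tmap (Lmul (star op) b) id (Delta a)
      - tmap id (Lmul (star op) b) (tswap (Delta a));
  nov_compat3 : forall a b,
    (tmap id (Rmul op a) \- tmap (Rmul op a) id) (Delta b + tswap (Delta b))
    = (tmap id (Rmul op b) \- tmap (Rmul op b) id) (Delta a + tswap (Delta a))
}.

Definition circ_q mul D Q (q : k) (a b : A) : A := mul a ((D + q *: Q) b).

Definition Delta_q delta D Q (q : k) (a : A) : tensor A A :=
  tmap id (Q + q *: D) (delta a).

End Structures.

(* Main.v *)
(* Put P = D + Q. The differential conditions say that D is a derivation and
   that P lies in the centroid, P(ab) = P(a)b = aP(b), and dually that
   (P (x) id) delta = (id (x) P) delta = delta P. Writing e = 1 - q, the operators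
   of the theorem are dA = D + qQ = eD + qP and dC = Q + qD = P - eD, which yields
   the Novikov algebra and coalgebra axioms for every q. The ASI condition says that
   E(a,b) = (L(a) (x) id - id (x) L(a)) delta(b) is symmetric in a and b, and up
   to multiples of (1 + 2q) L(a)P each side of compatibilities (2) and (3) is a
   fixed operator applied to E(a,b), resp. E(dA a, dA b); (1) likewise holds
   up to multiples of (1 + 2q) L(a)P. So everything reduces to
   (1 + 2q) aP(b) = 0, which holds when q = -1/2 or when aQ(b) = -aD(b). *)

From HB Require Import structures.
Require Import Defs.
From mathcomp Require Import all_boot all_order all_algebra.
From mathcomp Require Import ring.

Import GRing.Theory.
Local Open Scope ring_scope.

(** * Functoriality and linearity of tensor products of maps *)

Section TensorMaps.
Set Implicit Arguments.
Unset Strict Implicit.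
Variable k : fieldType.
Implicit Types U V W : vectType k.

Lemma linear_id U : linear (@id U).
Proof. by []. Qed.

Lemma linear_comp U V W (f : V -> W) (g : U -> V) :
  linear f -> linear g -> linear (f \o g).
Proof. by move=> lf lg a x y /=; rewrite lg lf. Qed.

Lemma tmap_linear U V U' V' (f : U -> U') (g : V -> V') : linear (tmap f g).
Proof. exact: tlift_linear. Qed.

Lemma tswap_linear U V : linear (@tswap k U V).
Proof. exact: tlift_linear. Qed.

Lemma tassoc_linear U V W : linear (@tassoc k U V W).
Proof. exact: tlift_linear. Qed.

Lemma tmapDt U V U' V' (f : U -> U') (g : V -> V') s t :
  tmap f g (s + t) = tmap f g s + tmap f g t.
Proof. by rewrite -[s]scale1r tmap_linear !scale1r. Qed.

Lemma tmap0 U V U' V' (f : U -> U') (g : V -> V') : tmap f g 0 = 0.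
Proof. by apply: (addrI (tmap f g 0)); rewrite -tmapDt !addr0. Qed.

Lemma tmapZt U V U' V' (f : U -> U') (g : V -> V') z t :
  tmap f g (z *: t) = z *: tmap f g t.
Proof. by rewrite -[z *: t]addr0 tmap_linear tmap0 addr0. Qed.

(** [tmap] takes bare functions, and pairs such as [id] and [\1%VF] agree only pointwise; this
    passes from the one to the other. *)
Lemma eq_tmap U V U' V' (f f' : U -> U') (g g' : V -> V') :
  f =1 f' -> g =1 g' -> tmap f g =1 tmap f' g'.
Proof.
move=> ef eg t; apply: eq_bigr => i _; apply: eq_bigr => j _.
by rewrite ef eg.
Qed.

Lemma tmap_comp U V U' V' U'' V'' (f : U' -> U'') (g : V' -> V'')
    (f' : U -> U') (g' : V -> V') (t : tensor U V) :
    linear f -> linear g -> linear f' -> linear g' ->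
  tmap f g (tmap f' g' t) = tmap (f \o f') (g \o g') t.
Proof.
move=> lf lg lf' lg'; move: t; apply: tensor_ext => [a x y|a x y|u v].
- by rewrite !tmap_linear.
- exact: tmap_linear.
- by rewrite !tmap_pure //; exact: linear_comp.
Qed.

Lemma tswap_tmap U V U' V' (f : U -> U') (g : V -> V') (t : tensor U V) :
  linear f -> linear g -> tswap (tmap f g t) = tmap g f (tswap t).
Proof.
move=> lf lg; move: t; apply: tensor_ext => [a x y|a x y|u v].
- by rewrite tmap_linear tswap_linear.
- by rewrite tswap_linear tmap_linear.
- by rewrite tmap_pure // !tswap_pure tmap_pure.
Qed.

Lemma tassoc_tmap U V W U' V' W' (f : U -> U') (g : V -> V') (h : W -> W')
    (t : tensor U (tensor V W)) :
    linear f -> linear g -> linear h ->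
  tassoc (tmap f (tmap g h) t) = tmap (tmap f g) h (tassoc t).
Proof.
move=> lf lg lh; move: t; apply: tensor_ext => [a x y|a x y|u].
- by rewrite tmap_linear tassoc_linear.
- by rewrite tassoc_linear tmap_linear.
apply: tensor_ext => [a x y|a x y|v w].
- by rewrite (tpure_bilinear _ _).2 tmap_linear tassoc_linear.
- by rewrite (tpure_bilinear _ _).2 tassoc_linear tmap_linear.
- have lfg := tmap_linear f g; have lgh := tmap_linear g h.
  by rewrite tassoc_pure !tmap_pure // tassoc_pure.
Qed.

Lemma tpureDl U V (u u' : U) (v : V) :
  tpure (u + u') v = tpure u v + tpure u' v.
Proof. by apply/matrixP=> i j; rewrite !mxE linearD mulrDl. Qed.

Lemma tpureDr U V (u : U) (v v' : V) :
  tpure u (v + v') = tpure u v + tpure u v'.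
Proof. by apply/matrixP=> i j; rewrite !mxE linearD mulrDr. Qed.

Lemma tpureZl U V c (u : U) (v : V) : tpure (c *: u) v = c *: tpure u v.
Proof. by apply/matrixP=> i j; rewrite !mxE linearZ mulrA. Qed.

Lemma tpureZr U V c (u : U) (v : V) : tpure u (c *: v) = c *: tpure u v.
Proof. by apply/matrixP=> i j; rewrite !mxE linearZ mulrCA. Qed.

Lemma tmapDl U V U' V' (f1 f2 : 'Hom(U, U')) (g : V -> V') t :
  tmap (f1 + f2)%R g t = tmap f1 g t + tmap f2 g t.
Proof.
rewrite /tmap /tlift -big_split; apply: eq_bigr => i _; rewrite -big_split.
by apply: eq_bigr => j _ /=; rewrite lfunE -scalerDr -tpureDl.
Qed.

Lemma tmap_addr U V U' V' (f : U -> U') (g1 g2 : V -> V') t :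
  tmap f (g1 \+ g2) t = tmap f g1 t + tmap f g2 t.
Proof.
rewrite /tmap /tlift -big_split; apply: eq_bigr => i _; rewrite -big_split.
by apply: eq_bigr => j _ /=; rewrite -scalerDr -tpureDr.
Qed.

Lemma tmap_scaler U V U' V' c (f : U -> U') (g : V -> V') t :
  tmap f (c \*: g) t = c *: tmap f g t.
Proof.
rewrite /tmap /tlift scaler_sumr; apply: eq_bigr => i _; rewrite scaler_sumr.
by apply: eq_bigr => j _ /=; rewrite tpureZr !scalerA mulrC.
Qed.

Lemma tmapDr U V U' V' (f : U -> U') (g1 g2 : 'Hom(V, V')) t :
  tmap f (g1 + g2)%R t = tmap f g1 t + tmap f g2 t.
Proof. by rewrite -tmap_addr; apply: eq_tmap => // x; rewrite add_lfunE. Qed.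

Lemma tmapZl U V U' V' c (f : 'Hom(U, U')) (g : V -> V') t :
  tmap (c *: f) g t = c *: tmap f g t.
Proof.
rewrite /tmap /tlift scaler_sumr; apply: eq_bigr => i _; rewrite scaler_sumr.
by apply: eq_bigr => j _ /=; rewrite lfunE /= tpureZl !scalerA mulrC.
Qed.

Lemma tmapZr U V U' V' c (f : U -> U') (g : 'Hom(V, V')) t :
  tmap f (c *: g) t = c *: tmap f g t.
Proof.
by rewrite -tmap_scaler; apply: eq_tmap => // x; rewrite scale_lfunE.
Qed.

End TensorMaps.

(** * Multiplication operators, the map [D + Q], and its behaviour on [delta] *)

Section NovikovBialgebra.
Set Implicit Arguments.
Unset Strict Implicit.

Variables (k : fieldType) (A : vectType k) (mul : A -> A -> A).
Variables (delta : A -> tensor A A) (D Q : 'End(A)).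
Hypothesis HA : comm_cocomm_diff_ASI_bialgebra mul delta D Q.
Implicit Types (a b c x y : A) (f g : 'End(A)) (t : tensor A A).

Let alg := ccd_alg HA.
Let coalg := ccd_coalg HA.
Let mul_bilinear : bilinear_for *:%R *:%R mul :=
  assoc_bilinear (acda_assoc alg).
Let mulA := assoc_mulA (acda_assoc alg).
Let mulC := acda_comm alg.
Let delta_linear := coassoc_linear (acdc_coassoc coalg).
Let delta_cocomm := acdc_cocomm coalg.

(** Bundled in ['End(A)], so that the compatibilities become identities between sums and
    compositions of operators. *)
Definition lmul a : 'End(A) :=
  let mul_a : {linear A -> A} := HB.pack (mul a)
    (GRing.isLinear.Build k A A *:%R (mul a) (mul_bilinear.2 a)) in
  linfun mul_a.

Lemma lmulE a b : lmul a b = mul a b.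
Proof. by rewrite lfunE. Qed.

Lemma mulDl a b c : mul (a + b) c = mul a c + mul b c.
Proof. by rewrite !(mulC _ c) -!lmulE linearD. Qed.

Lemma mulZl z a b : mul (z *: a) b = z *: mul a b.
Proof. by rewrite mulC -lmulE linearZ /= lmulE (mulC b). Qed.

Lemma lmulD a b : lmul (a + b) = lmul a + lmul b.
Proof. by apply/lfunP=> x; rewrite add_lfunE !lmulE mulDl. Qed.

Lemma lmulZ z a : lmul (z *: a) = z *: lmul a.
Proof. by apply/lfunP=> x; rewrite scale_lfunE !lmulE mulZl. Qed.

(* Locked, so that rewriting with additivity does not expand it back to D + Q. *)
Definition centroid : 'End(A) := locked (D + Q).

Lemma centroidE : centroid = D + Q.
Proof. by rewrite /centroid -lock. Qed.

Local Notation P := centroid.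

(** In [D(ba) + Q(ba)] the terms [b D(a)] and [- b D(a)] cancel, which leaves [P(b) a]. *)
Lemma P_mul a b : P (mul a b) = mul a (P b).
Proof.
rewrite mulC centroidE !add_lfunE (acda_D alg) (acda_Q alg) !(mulC _ a).
rewrite (mulC b) -!lmulE linearD /= !lmulE.
by rewrite addrACA subrr addr0.
Qed.

Lemma lmul_P a : lmul (P a) = (lmul a \o P)%VF.
Proof.
by apply/lfunP=> x; rewrite comp_lfunE !lmulE -P_mul mulC -P_mul mulC.
Qed.

Lemma P_lmul a : (P \o lmul a)%VF = (lmul a \o P)%VF.
Proof. by apply/lfunP=> x; rewrite !comp_lfunE !lmulE P_mul. Qed.

Lemma D_lmul a : (D \o lmul a)%VF = (lmul (D a) + (lmul a \o D))%VF.
Proof.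
by apply/lfunP=> x; rewrite add_lfunE !comp_lfunE !lmulE (acda_D alg).
Qed.

Lemma delta_mul a b :
  delta (mul a b)
  = tmap \1%VF (lmul a) (delta b) + tmap (lmul b) \1%VF (delta a).
Proof.
rewrite (asi_delta_mul (ccd_asi HA)).
by congr (_ + _); apply: eq_tmap => x; rewrite ?id_lfunE ?lmulE // mulC.
Qed.

Definition lmul_commutator a b : tensor A A :=
  tmap (lmul a) \1%VF (delta b) - tmap \1%VF (lmul a) (delta b).

Local Notation E := lmul_commutator.

Lemma lmul_commutatorE a b :
  (tmap (Lmul mul a) id \- tmap id (Rmul mul a)) (delta b) = E a b.
Proof.
rewrite /= /E; congr (_ - _).
  by apply: eq_tmap => x; rewrite ?lmulE ?id_lfunE.
by apply: eq_tmap => x; rewrite ?lmulE ?id_lfunE //; exact: mulC.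
Qed.

(** By cocommutativity the flip exchanges the two terms of [E a b]. *)
Lemma tswap_lmul_commutator a b : tswap (E a b) = - E a b.
Proof.
have lL := linearP (lmul a); have l1 := linearP (\1%VF : 'End(A)).
rewrite /E -scaleN1r addrC tswap_linear !tswap_tmap //.
by rewrite -!delta_cocomm !scaleN1r opprD opprK addrC.
Qed.

Lemma lmul_commutatorC a b : E a b = E b a.
Proof.
have := asi_antisym (ccd_asi HA) a b.
by rewrite !lmul_commutatorE tswap_lmul_commutator => /subr0_eq.
Qed.

Lemma delta_linE : (forall z a, delta (z *: a) = z *: delta a) *
  (forall a b, delta (a + b) = delta a + delta b).
Proof.
split=> [z a|a b]; last by rewrite -[a]scale1r delta_linear !scale1r.
have d0 : delta 0 = 0.
  have := delta_linear 1 0 0; rewrite !scale1r addr0 => /eqP.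
  by rewrite -subr_eq subrr => /eqP.
by rewrite -[z *: a]addr0 delta_linear d0 !addr0.
Qed.

Lemma deltaE_Q a :
  delta (Q a) = tmap \1%VF Q (delta a) + tmap Q \1%VF (delta a).
Proof.
by rewrite (acdc_Q coalg); congr (_ + _); apply: eq_tmap => x //;
  rewrite id_lfunE.
Qed.

Lemma deltaE_D a :
  delta (D a) = tmap D \1%VF (delta a) - tmap \1%VF Q (delta a).
Proof.
by rewrite (acdc_D coalg); congr (_ - _); apply: eq_tmap => x //;
  rewrite id_lfunE.
Qed.

(** The terms [id (x) Q] of the rules for [D] and [Q] cancel. *)
Lemma delta_Pl a : delta (P a) = tmap P \1%VF (delta a).
Proof.
by rewrite centroidE add_lfunE delta_linE deltaE_D deltaE_Q addrA subrK tmapDl.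
Qed.

Lemma delta_Pr a : delta (P a) = tmap \1%VF P (delta a).
Proof.
rewrite delta_cocomm delta_Pl tswap_tmap -?delta_cocomm //; exact: linearP.
Qed.

Lemma tmap_compE (f g f' g' : 'End(A)) t :
  tmap f g (tmap f' g' t) = tmap (f \o f')%VF (g \o g')%VF t.
Proof.
rewrite tmap_comp; try exact: linearP.
by apply: eq_tmap => x; rewrite comp_lfunE.
Qed.

(** Both sides are [tmap f g (delta (P a))]: on the image of [delta], [P] may change legs. *)
Lemma tmap_P f g a :
  tmap (f \o P)%VF g (delta a) = tmap f (g \o P)%VF (delta a).
Proof.
rewrite -[in LHS](comp_lfun1r g) -[in RHS](comp_lfun1r f) -!tmap_compE.
by rewrite -delta_Pl delta_Pr.
Qed.

Lemma tmap_P1 g a : tmap P g (delta a) = tmap \1%VF (g \o P)%VF (delta a).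
Proof. by rewrite -tmap_P comp_lfun1l. Qed.

Lemma delta_D a :
  delta (D a) =
    tmap D \1%VF (delta a) + tmap \1%VF D (delta a) - tmap \1%VF P (delta a).
Proof.
by rewrite deltaE_D centroidE tmapDr opprD addrA addrK.
Qed.

(** * The operations in terms of [dA] and [dC], and compatibility (1) *)

Variable q : k.
Hypothesis mulP0 : forall a b, (1 + 2 * q) *: mul a (P b) = 0.

Local Notation circ := (circ_q mul D Q q).
Local Notation Delta := (Delta_q delta D Q q).
Local Notation e := (1 - q).

Let dA : 'End(A) := e *: D + q *: P.
Let dC : 'End(A) := P + (- e) *: D.

Let dAE : D + q *: Q = dA.
Proof. by rewrite /dA centroidE !scalerDr addrA -scalerDl subrK scale1r. Qed.

Let dCE : Q + q *: D = dC.
Proof.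
rewrite /dC centroidE scaleNr scalerBl scale1r opprB [D + Q]addrC -addrA.
by rewrite [D + _]addrC subrK.
Qed.

Lemma lmul_dA a : lmul (dA a) = e *: lmul (D a) + q *: (lmul a \o P)%VF.
Proof. by rewrite /dA add_lfunE !scale_lfunE lmulD !lmulZ lmul_P. Qed.

Lemma circE a b : circ a b = mul a (dA b).
Proof. by rewrite /circ_q dAE. Qed.

Lemma DeltaE a : Delta a = tmap \1%VF dC (delta a).
Proof. by rewrite /Delta_q dCE; apply: eq_tmap => x; rewrite ?id_lfunE. Qed.

Lemma tswap_Delta a : tswap (Delta a) = tmap dC \1%VF (delta a).
Proof. by rewrite DeltaE tswap_tmap -?delta_cocomm //; exact: linearP. Qed.

Lemma circ_star_lmul a : Lmul (star circ) a =1 (lmul a \o dA + lmul (dA a))%VF.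
Proof.
move=> x; rewrite /Lmul /star add_lfunE comp_lfunE !circE !lmulE.
by rewrite (mulC x).
Qed.

Lemma circ_Rmul a : Rmul circ a =1 lmul (dA a).
Proof. by move=> x; rewrite /Rmul circE lmulE mulC. Qed.

Lemma comp_lmul_P0 a : (1 + 2 * q) *: (lmul a \o P)%VF = 0.
Proof.
by apply/lfunP=> x; rewrite scale_lfunE comp_lfunE lmulE mulP0 lfunE.
Qed.

(** Companion of [D_lmul] for right-nested compositions, where [D \o lmul a] is not a subterm. *)
Lemma D_lmulA a f :
  (D \o (lmul a \o f))%VF = ((lmul (D a) \o f) + (lmul a \o (D \o f)))%VF.
Proof. by rewrite comp_lfunA D_lmul comp_lfunDl -comp_lfunA. Qed.

Lemma P_lmulA a f : (P \o (lmul a \o f))%VF = (lmul a \o (P \o f))%VF.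
Proof. by rewrite comp_lfunA P_lmul -comp_lfunA. Qed.

Let comp_lfunZE := (fun z f g => esym (@comp_lfunZl _ A A A z f g),
   fun z f g => esym (@comp_lfunZr _ A A A z f g)).

(* The two sides differ by the combination of [h1]..[h4] below, whose terms all
   contain [lmul a \o P], multiplied by 1 + 2q. *)
Lemma Delta_circ a b :
  Delta (circ a b) = tmap (Rmul circ b) id (Delta a)
    + tmap id (Lmul (star circ) a) (Delta b + tswap (Delta b)).
Proof.
rewrite (eq_tmap (circ_Rmul b) (fun x => esym (id_lfunE x))).
rewrite (eq_tmap (fun x => esym (id_lfunE x)) (circ_star_lmul a)).
rewrite tswap_Delta !DeltaE circE delta_mul tmapDt [LHS]addrC.
(* Both sides share [tmap (lmul (dA b)) dC (delta a)]; only terms in [delta b] remain. *)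
rewrite !tmap_compE !comp_lfun1l !comp_lfun1r; congr (_ + _).
rewrite {1}/dA add_lfunE !scale_lfunE !delta_linE delta_D delta_Pr -scaleN1r.
have zero f g : (1 + 2 * q) *: tmap f (lmul a \o (P \o g))%VF (delta b) = 0.
  rewrite -tmapZr comp_lfunA comp_lfunZl comp_lmul_P0 comp_lfun0l.
  by rewrite -(scale0r 0) tmapZr scale0r.
rewrite lmul_dA /dA /dC.
rewrite !(tmapDt, tmapZt).
rewrite !(tmap_compE, comp_lfun1l, comp_lfun1r).
rewrite !(comp_lfunDl, comp_lfunDr, comp_lfunZE, comp_lfun1l, comp_lfun1r).
rewrite -!comp_lfunA.
rewrite !(D_lmul, P_lmul, D_lmulA, P_lmulA).
rewrite !(tmapDl, tmapDr, tmapZl, tmapZr) !tmap_P1 -!comp_lfunA.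
(* [D] and [P] are not assumed to commute, so [zero] does not cover [lmul a \o (D \o P)]. Applying
   [D] to an instance of [zero] yields it, together with [lmul (D a) \o P]. *)
have := congr1 (tmap \1%VF D) (zero \1%VF \1%VF).
have := zero D \1%VF; have := zero \1%VF D; have := zero \1%VF P.
rewrite tmapZt tmap_compE !(comp_lfun1l, comp_lfun1r) D_lmulA tmapDr tmap0.
set t1 := tmap _ _ _; set t2 := tmap _ _ _; set t3 := tmap _ _ _.
set t4 := tmap _ _ _; set t5 := tmap _ _ _.
move=> h1 h2 h3 h4; apply: subr0_eq.
transitivity (e *: ((1 + 2 * q) *: t3) + e *: ((1 + 2 * q) *: t2)
  - e *: ((1 + 2 * q) *: (t4 + t5)) - (1 + 2 * q) *: t1); last first.
  by rewrite h1 h2 h3 h4 !scaler0 subr0 addr0 subr0.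
by apply/matrixP=> i j; rewrite !mxE; ring.
Qed.

(** * Compatibilities (2) and (3) *)

Let lmulP0l f a t : (1 + 2 * q) *: tmap (lmul a \o P)%VF f t = 0.
Proof. by rewrite -tmapZl comp_lmul_P0 -(scale0r 0) tmapZl scale0r. Qed.

Let lmulP0r f a t : (1 + 2 * q) *: tmap f (lmul a \o P)%VF t = 0.
Proof. by rewrite -tmapZr comp_lmul_P0 -(scale0r 0) tmapZr scale0r. Qed.

(** By the Leibniz rule, left [star]-multiplication by [a] is [(e D + 2q P) \o lmul a]. The two
    terms thus carry the operators [(e D + 2q P) (x) (P - e D)] and [(P - e D) (x) (e D + 2q P)];
    these coincide once the coefficient [- 2qe] of the mixed terms is replaced by [e], an error that
    [mulP0] kills. *)
Lemma Delta_star a b :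
  tmap (Lmul (star circ) a) id (Delta b)
    - tmap id (Lmul (star circ) a) (tswap (Delta b))
  = - e ^+ 2 *: tmap D D (E a b) + e *: (tmap D P (E a b) + tmap P D (E a b))
    + (2 * q) *: tmap P P (E a b).
Proof.
rewrite (eq_tmap (circ_star_lmul a) (fun x => esym (id_lfunE x))).
rewrite (eq_tmap (fun x => esym (id_lfunE x)) (circ_star_lmul a)).
rewrite tswap_Delta DeltaE lmul_dA /dA /dC.
rewrite /E -!scaleN1r !(tmapDt, tmapZt, tmap_compE).
rewrite !(comp_lfunDl, comp_lfunDr, comp_lfunZE, comp_lfun1l, comp_lfun1r).
rewrite !(D_lmul, P_lmul) !(tmapDl, tmapDr, tmapZl, tmapZr).
have := lmulP0l D a (delta b); have := lmulP0r D a (delta b).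
set t1 := tmap _ _ _; set t2 := tmap _ _ _ => h1 h2; apply: subr0_eq.
transitivity (e *: ((1 + 2 * q) *: t1) - e *: ((1 + 2 * q) *: t2)); last first.
  by rewrite h1 h2 !scaler0 subr0.
by apply/matrixP=> i j; rewrite !mxE; ring.
Qed.

(** On [delta b], [P] on either leg gives [delta (P b)], and [D (x) id + id (x) D] gives
    [delta (D b + P b)]. The multiple of [P b] is split off because [E a] annihilates it. *)
Lemma Delta_swap b :
  Delta b + tswap (Delta b) = delta ((1 + 2 * q) *: P b - dA b).
Proof.
rewrite -scaleN1r tswap_Delta DeltaE /dA /dC add_lfunE !scale_lfunE !delta_linE.
rewrite delta_D delta_Pr !(tmapDl, tmapDr, tmapZl, tmapZr) tmap_P1 comp_lfun1l.
by apply/matrixP=> i j; rewrite !mxE; ring.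
Qed.

(** In each term [P] is moved to the leg on which [lmul a] acts. *)
Lemma lmul_commutator_P0 a b : E a ((1 + 2 * q) *: P b) = 0.
Proof.
rewrite /E delta_linE {1}delta_Pl delta_Pr !tmapZt !tmap_compE comp_lfun1l.
by rewrite lmulP0l lmulP0r subr0.
Qed.

Lemma lmul_commutatorB a b c : E a (b - c) = E a b - E a c.
Proof.
rewrite /E -(scaleN1r c) !delta_linE !tmapDt !tmapZt.
by apply/matrixP=> i j; rewrite !mxE; ring.
Qed.

Lemma Delta_Rmul a b :
  (tmap id (Rmul circ a) \- tmap (Rmul circ a) id) (Delta b + tswap (Delta b))
  = E (dA a) (dA b).
Proof.
rewrite Delta_swap /=.
rewrite (eq_tmap (circ_Rmul a) (fun x => esym (id_lfunE x))).
rewrite (eq_tmap (fun x => esym (id_lfunE x)) (circ_Rmul a)).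
by rewrite -opprB -/(E _ _) lmul_commutatorB lmul_commutator_P0 sub0r opprK.
Qed.

(** * The Novikov algebra and coalgebra axioms *)

Lemma circ_novikov : novikov_algebra circ.
Proof.
split.
- split=> [b|a] z x y; rewrite !circE; first by rewrite mulDl mulZl.
  by rewrite -!lmulE !linearP.
- move=> a b c; rewrite !circE.
  (* With this rule the associator of [a], [b], [c] is [- e a b D(dA c)], symmetric in [a] and
     [b]. *)
  have dA_mul x y : dA (mul x y) = mul (dA x) y + e *: mul x (D y).
    rewrite {1}/dA add_lfunE !scale_lfunE P_mul (acda_D alg).
    rewrite /dA add_lfunE !scale_lfunE mulDl !mulZl -P_mul (mulC (P x)).
    by rewrite -P_mul (mulC y) scalerDr addrAC.
  have mulD x y z : mul x (y + e *: z) = mul x y + e *: mul x z.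
    by rewrite -!lmulE linearD linearZ.
  rewrite !dA_mul !mulD !mulA !opprD !addrA !subrr !sub0r.
  by rewrite -!mulA (mulC a).
- by move=> a b c; rewrite !circE !mulA (mulC (dA b)).
Qed.

(** Dual to the product rule for [dA], with [Q] in the place of [D]. *)
Lemma delta_dC a :
  delta (dC a) = tmap dC id (delta a) + e *: tmap id Q (delta a).
Proof.
rewrite -dCE add_lfunE scale_lfunE !delta_linE deltaE_D deltaE_Q.
have -> : tmap (Q + q *: D) id (delta a) = tmap (Q + q *: D) \1%VF (delta a).
  by apply: eq_tmap => x; rewrite ?id_lfunE.
have -> : tmap id Q (delta a) = tmap \1%VF Q (delta a).
  by apply: eq_tmap => x; rewrite ?id_lfunE.
by rewrite tmapDl tmapZl; apply/matrixP=> i j; rewrite !mxE; ring.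
Qed.

(** Coassociativity writes every iterated coproduct as an operator on [tmap delta id (delta a)].
    There, by cocommutativity, flipping the first two legs only permutes the operators on them
    ([swap12]). *)
Lemma Delta_novikov : novikov_coalgebra Delta.
Proof.
have ld : linear dC by exact: linearP.
have lQ : linear Q by exact: linearP.
have l1 := @linear_id k A.
have lm (f g : A -> A) : linear (tmap f g) by exact: tmap_linear.
have lD : linear Delta.
  by move=> z x y; rewrite /Delta_q delta_linear tmap_linear.
have ls := @tswap_linear k A A.
have ldQ : linear (dC \o Q) by exact: linear_comp.
have DE : Delta =1 tmap id dC \o delta.
  by move=> x; rewrite DeltaE; apply: eq_tmap => y; rewrite ?id_lfunE.
have coA a : tassoc (tmap id delta (delta a)) = tmap delta id (delta a).
  by rewrite (coassoc_coA (acdc_coassoc coalg)).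
have swap12 a (f g : A -> A) h : linear f -> linear g -> linear h ->
    tmap (@tswap k A A) id (tmap (tmap f g) h (tmap delta id (delta a)))
    = tmap (tmap g f) h (tmap delta id (delta a)).
  move=> lf lg lh; rewrite !tmap_comp //; try exact: linear_comp.
  by apply: eq_tmap => x //=; rewrite tswap_tmap // -delta_cocomm.
have DeltaD a : tmap Delta id (Delta a)
    = tmap (tmap id dC) dC (tmap delta id (delta a)).
  by rewrite (DE a) /= !tmap_comp //; apply: eq_tmap => x //=; rewrite DE.
have assocE a (h f g : A -> A) : linear h -> linear f -> linear g ->
    tassoc (tmap h (tmap f g \o delta) (delta a))
    = tmap (tmap h f) g (tmap delta id (delta a)).
  by move=> lh lf lg; rewrite -coA -tassoc_tmap // tmap_comp.
split => // a.
- rewrite DeltaD.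
  (* The two iterated coproducts differ only by [e (id (x) id (x) dC Q)], which the flip fixes. *)
  have -> : tassoc (tmap id Delta (Delta a))
      = tmap (tmap id dC) dC (tmap delta id (delta a))
        + e *: tmap (tmap id id) (dC \o Q) (tmap delta id (delta a)).
    rewrite -coA -!tassoc_tmap //.
    rewrite [RHS]addrC -tassoc_linear [e *: _ + _]addrC.
    rewrite (DE a) /= !tmap_comp // -tmap_scaler -tmap_addr.
    congr tassoc; apply: eq_tmap => x //=.
    by rewrite DE /= delta_dC tmapDt tmapZt !tmap_comp.
  by rewrite !tmapDt !tmapZt !swap12 // opprD addrACA subrr addr0.
- rewrite DeltaD.
  have -> : tswap (Delta a) = tmap dC id (delta a).
    by rewrite tswap_Delta; apply: eq_tmap => y; rewrite ?id_lfunE.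
  rewrite tmap_comp //.
  have -> : tmap (id \o dC) (Delta \o id) (delta a)
      = tmap dC (tmap id dC \o delta) (delta a).
    by apply: eq_tmap => x //=; rewrite DE.
  by rewrite assocE // swap12.
Qed.

(** * Assembly of the bialgebra and specialization of [q] *)

Lemma circ_Delta_novikov : novikov_bialgebra circ Delta.
Proof.
split; first exact: circ_novikov.
- exact: Delta_novikov.
- exact: Delta_circ.
- by move=> a b; rewrite !Delta_star (lmul_commutatorC a).
- by move=> a b; rewrite !Delta_Rmul lmul_commutatorC.
Qed.
End NovikovBialgebra.

Theorem theorem2p20 (k : fieldType) (char0 : [pchar k] =i pred0)
    (A : vectType k) (mul : A -> A -> A) (delta : A -> tensor A A)
    (D Q : 'End(A))
    (HA : comm_cocomm_diff_ASI_bialgebra mul delta D Q) :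
  novikov_bialgebra (circ_q mul D Q (- (1 / 2))) (Delta_q delta D Q (- (1 / 2)))
  /\ (forall q : k, q != - (1 / 2) ->
        (forall a b : A, mul a (Q b) = - mul a (D b)) ->
        (forall a : A, tmap id Q (delta a) = - tmap id D (delta a)) ->
        novikov_bialgebra (circ_q mul D Q q) (Delta_q delta D Q q))
  /\ (forall q : k, Q = - D ->
        novikov_bialgebra (circ_q mul D Q q) (Delta_q delta D Q q)).
Proof.
have mulDr x y z : mul x (y + z) = mul x y + mul x z.
  by rewrite -!(lmulE HA) linearD.
(* Here [a P(b) = a D(b) + a Q(b)] vanishes, whatever [q] is. *)
have mul0 : (forall a b, mul a (Q b) = - mul a (D b)) ->
    forall (q : k) a b, (1 + 2 * q) *: mul a (centroid D Q b) = 0.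
  by move=> mulQ q a b; rewrite centroidE add_lfunE mulDr mulQ subrr scaler0.
have mulN x y : mul x (- y) = - mul x y.
  by rewrite -!(lmulE HA) linearN.
split; last split.
- apply: circ_Delta_novikov => // a b.
  (* Here the scalar [1 + 2q] vanishes; characteristic 0 makes 2 invertible. *)
  have two0 : (2 : k) != 0 by rewrite ((pcharf0P k).1 char0).
  by rewrite mulrN mul1r divff // subrr scale0r.
- by move=> q _ mulQ _; apply: circ_Delta_novikov => // a b; exact: mul0.
- move=> q QN; apply: circ_Delta_novikov => // a b; apply: mul0 => {}a {}b.
  by rewrite QN opp_lfunE mulN.
Qed.
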